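(* Let $\varphi:\mathbf{R}^2\to\mathbf{R}^2$ be an invertible, non-isometric linear operator whose characteristic polynomial has two non-real complex conjugate roots, and let $\varphi=\psi\,\varphi'$ (first apply $\varphi'$, then $\psi$) be its polar decomposition, where $\varphi'$ is a positive self-adjoint operator with eigenvalues $\sqrt{\lambda},\sqrt{\mu}>0$ and $\psi$ is the rotation through angle $\alpha$. For every nonzero $\mathbf{x}\in\mathbf{R}^2$, let $\gamma$ be the oriented angle from $\mathbf{x}$ to $\varphi(\mathbf{x})$, normalized to lie in $(\alpha-\pi,\alpha+\pi]$. Then $$\alpha-\arccos\frac{2\sqrt[4]{\lambda\mu}}{\sqrt{\lambda}+\sqrt{\mu}}\leqslant\gamma\leqslant\alpha+\arccos\frac{2\sqrt[4]{\lambda\mu}}{\sqrt{\lambda}+\sqrt{\mu}}.$$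
   Context: $\mathbf{R}^2$ is the standard Euclidean plane. If $A$ is the matrix of $\varphi$ in the standard basis, then having complex spectrum (two non-real conjugate characteristic roots) forces $\det A>0$. The polar decomposition is $A=OB$, where $B$ is the symmetric positive definite matrix with $B^2=A^{\mathrm t}A$ (the matrix of $\varphi'$) and $O=AB^{-1}$ is orthogonal with $\det O>0$ (the matrix of $\psi$), so that $O=\begin{pmatrix}\cos\alpha&-\sin\alpha\\ \sin\alpha&\cos\alpha\end{pmatrix}$ for a real number $\alpha$ (determined modulo $2\pi$; fix any such $\alpha$). The numbers $\lambda,\mu>0$ are the eigenvalues of $A^{\mathrm t}A$, so $\sqrt\lambda,\sqrt\mu$ are the eigenvalues of $B$. The oriented angle from a nonzero vector $\mathbf{x}$ to a nonzero vector $\mathbf{y}$ is the angle (modulo $2\pi$) of the counterclockwise rotation taking the direction of $\mathbf{x}$ to the direction of $\mathbf{y}$. *)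

(* Defs.v *)
From HB Require Import structures.
From mathcomp Require Import all_boot all_order all_algebra.
From mathcomp Require Import all_classical all_reals all_analysis.
From mathcomp Require Import complex.

Set Implicit Arguments.
Unset Strict Implicit.
Unset Printing Implicit Defensive.

Import Order.TTheory GRing.Theory Num.Theory.
Local Open Scope ring_scope.

(* MathComp-Analysis, with the real numbers an arbitrary [R : realType].
   Points of the plane are row vectors, so that the library's matrix of a
   linear operator, [lin1_mx f] (with [x *m lin1_mx f = f x]), can be used. It
   is the transpose of the matrix acting on columns, which does not change the
   characteristic polynomial. *)

Section EuclideanPlane.
Variable R : realType.
Implicit Types (x y : 'rV[R]_2) (f : {linear 'rV[R]_2 -> 'rV[R]_2}).

Definition dot x y : R := \sum_(i < 2) x 0 i * y 0 i.

(* The library norm on matrices is the sup norm, hence this one. *)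
Definition enorm x : R := Num.sqrt (dot x x).

Definition isometric f : Prop := forall x, enorm (f x) = enorm x.

Definition self_adjoint f : Prop := forall x y, dot (f x) y = dot x (f y).

Definition positive_operator f : Prop := forall x, x != 0 -> 0 < dot (f x) x.

Definition op_char_poly f : {poly R} := char_poly (lin1_mx f).

Definition has_nonreal_conjugate_roots (p : {poly R}) : Prop :=
  exists z : R[i], [/\ complex.Im z != 0,
    root (map_poly (real_complex R) p) z &
    root (map_poly (real_complex R) p) (conjc z)].

(* [a] and [b] are the eigenvalues of [f] counted with multiplicity: [a = b]
   means that [a] is a double root of the characteristic polynomial. *)
Definition has_eigenvalues f (a b : R) : Prop :=
  op_char_poly f = ('X - a%:P) * ('X - b%:P).

Definition rotation (t : R) x : 'rV[R]_2 :=
  \row_(i < 2) (if i == 0 then cos t * x 0 0 - sin t * x 0 1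
                else sin t * x 0 0 + cos t * x 0 1).

(* [f = o p], with [p] applied first. *)
Definition polar_decomposition f (o p : {linear 'rV[R]_2 -> 'rV[R]_2}) : Prop :=
  [/\ forall x, f x = o (p x), isometric o, self_adjoint p
    & positive_operator p].

Definition direction x : 'rV[R]_2 := (enorm x)^-1 *: x.

(* [t] is a representative of the oriented angle (defined modulo 2 pi) from [x]
   to [y]; only meaningful for nonzero [x] and [y]. *)
Definition oriented_angle x y (t : R) : Prop :=
  rotation t (direction x) = direction y.

End EuclideanPlane.

(* Main.v *)
Require Import Defs.
From HB Require Import structures.
From mathcomp Require Import all_boot all_order all_algebra.
From mathcomp Require Import all_classical all_reals all_analysis.
From mathcomp Require Import complex ring lra.

Import Order.TTheory GRing.Theory Num.Theory.
Local Open Scope ring_scope.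

(** Rotating back by [alpha], the angle [t = gamma - alpha], which lies in
    [(- pi, pi]], is the oriented angle from [x] to [y = phi' x]; so
    [cos t = dot y x / (enorm x * enorm y)], and since [acos] is decreasing
    the theorem is a lower bound for the cosine of the angle by which a
    positive operator can deviate a vector: a form of Kantorovich's inequality.

    That bound needs no eigenbasis. Let [a], [b] be the eigenvalues of [phi'].
    By Cayley-Hamilton, [phi' y = (a + b) y - a b x]; pairing with [x] and
    using self-adjointness gives
      [(a + b) dot y x = dot y y + a b dot x x]  ([dot_eigenvalues]),
    and the right-hand side is at least [2 sqrt (a b) * enorm x * enorm y] by
    the inequality between arithmetic and geometric means
    ([angle_eigenvalues]). *)

Section Plane.
Context {R : realType}.
Implicit Types (x y : 'rV[R]_2) (f : {linear 'rV[R]_2 -> 'rV[R]_2}).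

Lemma rowP2 x y : x 0 0 = y 0 0 -> x 0 1 = y 0 1 -> x = y.
Proof.
move=> xy0 xy1; apply/rowP => -[[|[|//]] i2].
- by rewrite (_ : Ordinal i2 = 0) //; apply: val_inj.
- by rewrite (_ : Ordinal i2 = 1) //; apply: val_inj.
Qed.

Lemma dot2E x y : dot x y = x 0 0 * y 0 0 + x 0 1 * y 0 1.
Proof.
rewrite /dot big_ord_recl big_ord1.
by have -> : lift ord0 ord0 = 1 :> 'I_2 by apply: val_inj.
Qed.

Lemma dotC x y : dot x y = dot y x.
Proof. by rewrite !dot2E; ring. Qed.

Lemma dotDl x y z : dot (x + y) z = dot x z + dot y z.
Proof. by rewrite !dot2E !mxE; ring. Qed.

Lemma dotZl k x y : dot (k *: x) y = k * dot x y.
Proof. by rewrite !dot2E !mxE; ring. Qed.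

Lemma dot_ge0 x : 0 <= dot x x.
Proof. by rewrite dot2E addr_ge0 // -expr2 sqr_ge0. Qed.

Lemma dot0l x : dot 0 x = 0.
Proof. by rewrite dot2E !mxE !mul0r addr0. Qed.

Lemma sqr_enorm x : enorm x ^+ 2 = dot x x.
Proof. by rewrite sqr_sqrtr ?dot_ge0. Qed.

Lemma enorm_gt0 x : x != 0 -> 0 < enorm x.
Proof.
move=> x0; rewrite sqrtr_gt0 lt_neqAle dot_ge0 andbT eq_sym.
apply: contra x0 => /eqP; rewrite dot2E -!expr2 => /eqP.
rewrite paddr_eq0 ?sqr_ge0// !sqrf_eq0 => /andP[/eqP x00 /eqP x01].
by apply/eqP/rowP2; rewrite mxE.
Qed.

Lemma dot_rotation s t x y :
  dot (rotation s x) (rotation t y) = dot (rotation (s - t) x) y.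
Proof. by rewrite !dot2E !mxE /= cosB sinB; ring. Qed.

Lemma rotation0 x : rotation 0 x = x.
Proof.
by apply: rowP2; rewrite mxE /= cos0 sin0 !mul0r mul1r ?subr0 ?add0r.
Qed.

Lemma dot_rotation_self t x : dot (rotation t x) x = cos t * dot x x.
Proof. by rewrite !dot2E !mxE /=; ring. Qed.

Lemma rotationZ t k x : rotation t (k *: x) = k *: rotation t x.
Proof. by apply/rowP => i; rewrite !mxE; case: ifP => _; ring. Qed.

Lemma enorm_rotation t x : enorm (rotation t x) = enorm x.
Proof. by rewrite /enorm dot_rotation subrr rotation0. Qed.

(** The Cayley-Hamilton relation [(f - a) (f - b) = 0], evaluated at a vector. *)
Lemma Cayley_Hamilton_eigenvalues f a b x : has_eigenvalues f a b ->
  f (f x) = (a + b) *: f x - (a * b) *: x.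
Proof.
move=> fab; have := Cayley_Hamilton (lin1_mx f).
rewrite [char_poly _]fab rmorphM !rmorphB /= horner_mx_X !horner_mx_C.
move=> /(congr1 (mulmx x)); rewrite mulmx0 mulmxA !mulmxBr.
rewrite !mul_mx_scalar !mul_rV_lin1 linearB linearZ.
move=> /rowP fx; apply/rowP => i; move: (fx i); rewrite !mxE; lra.
Qed.

(** Pairing the Cayley-Hamilton relation with [x]: self-adjointness turns
    [dot (f (f x)) x] into the squared norm of [f x]. *)
Lemma dot_eigenvalues f a b x : self_adjoint f -> has_eigenvalues f a b ->
  (a + b) * dot (f x) x = dot (f x) (f x) + a * b * dot x x.
Proof.
move=> f_sa fab; have := f_sa (f x) x.
rewrite (Cayley_Hamilton_eigenvalues _ _ _ _ fab) -scaleNr dotDl !dotZl; lra.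
Qed.

(** When [q] is a square root of [a * b], the difference of the two sides is
    [(enorm (f x) - q * enorm x) ^+ 2], by [dot_eigenvalues]. *)
Lemma angle_eigenvalues f a b q x : self_adjoint f -> has_eigenvalues f a b ->
  q ^+ 2 = a * b -> 2 * q * (enorm x * enorm (f x)) <= (a + b) * dot (f x) x.
Proof.
move=> f_sa fab qab; rewrite (dot_eigenvalues _ _ _ _ f_sa fab) -qab.
rewrite -!sqr_enorm -subr_ge0.
set u := enorm x; set v := enorm (f x).
by rewrite (_ : _ - _ = (v - q * u) ^+ 2) ?sqr_ge0//; ring.
Qed.

(** A common rotation of both vectors cancels in the angle between them. *)
Lemma cos_oriented_angle x y alpha gamma : x != 0 -> y != 0 ->
  oriented_angle x (rotation alpha y) gamma ->
  cos (gamma - alpha) * (enorm x * enorm y) = dot y x.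
Proof.
move=> x0 y0; rewrite /oriented_angle /direction rotationZ enorm_rotation.
move=> /(congr1 (fun v => dot v (rotation alpha x))).
rewrite !dotZl !dot_rotation subrr rotation0 dot_rotation_self -sqr_enorm.
have := enorm_gt0 _ x0; have := enorm_gt0 _ y0.
move: (enorm x) (enorm y) => u v v0 u0 e.
have -> : dot y x = v * (v^-1 * dot y x) by rewrite mulVKf ?gt_eqF.
by rewrite -e; field; rewrite gt_eqF.
Qed.

Lemma norm_le_acos (c t : R) : -1 <= c -> `|t| <= pi -> c <= cos t ->
  `|t| <= acos c.
Proof.
move=> c_ge t_le ct.
have cos_le1 := cos_le1 t.
have c_in : -1 <= c <= 1 by rewrite c_ge (le_trans ct).
have t_in : `|t| \in `[0, pi] by rewrite in_itv /= normr_ge0.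
have acos_in : acos c \in `[0, pi] by rewrite in_itv /= acos_ge0 ?acos_lepi.
by rewrite leNgt -ltr_cos // -leNgt acosK ?in_itv //= cos_norm.
Qed.

End Plane.

Lemma sqr_powR_inv4 {R : realType} (l m : R) : 0 < l -> 0 < m ->
  ((l * m) `^ (4^-1)) ^+ 2 = Num.sqrt l * Num.sqrt m.
Proof.
move=> l0 m0; rewrite -powR_mulrn ?powR_ge0// -powRrM.
have -> : 4^-1 * 2%:R = 2^-1 :> R by field.
by rewrite powR12_sqrt ?mulr_ge0 ?sqrtrM ?ltW.
Qed.

Theorem theorem2 (R : realType)
    (phi psi phi' : {linear 'rV[R]_2 -> 'rV[R]_2}) (lambda mu alpha : R)
    (phi_invertible : bijective phi)
    (phi_not_isometric : ~ isometric phi)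
    (phi_spectrum : has_nonreal_conjugate_roots (op_char_poly phi))
    (phi_polar : polar_decomposition phi psi phi')
    (lambda_gt0 : 0 < lambda) (mu_gt0 : 0 < mu)
    (phi'_eigen : has_eigenvalues phi' (Num.sqrt lambda) (Num.sqrt mu))
    (psi_rotation : forall v : 'rV[R]_2, psi v = rotation alpha v)
    (x : 'rV[R]_2) (x_neq0 : x != 0)
    (gamma : R) (gamma_angle : oriented_angle x (phi x) gamma)
    (gamma_range : alpha - pi < gamma <= alpha + pi) :
  let delta := acos (2 * ((lambda * mu) `^ (4^-1))
                     / (Num.sqrt lambda + Num.sqrt mu)) in
  alpha - delta <= gamma <= alpha + delta.
Proof.
case: phi_polar => phiE _ phi'_sa phi'_pos; cbv zeta.
have y_neq0 : phi' x != 0.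
  by apply/eqP => y0; have := phi'_pos _ x_neq0; rewrite y0 dot0l ltxx.
have ab_gt0 : 0 < Num.sqrt lambda + Num.sqrt mu by rewrite addr_gt0 ?sqrtr_gt0.
have cosE : cos (gamma - alpha) * (enorm x * enorm (phi' x)) = dot (phi' x) x.
  by apply: cos_oriented_angle; rewrite // -psi_rotation -phiE.
have := angle_eigenvalues _ _ _ _ x phi'_sa phi'_eigen
  (sqr_powR_inv4 _ _ lambda_gt0 mu_gt0).
rewrite -cosE [leRHS]mulrA ler_pM2r ?mulr_gt0 ?enorm_gt0// => bound.
rewrite -ler_distlC distrC; apply: norm_le_acos.
- apply: (@le_trans _ _ 0); first by rewrite oppr_le0.
  by rewrite divr_ge0 ?mulr_ge0 ?powR_ge0 ?(ltW ab_gt0).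
- by rewrite distrC ler_distlC; case/andP: gamma_range => /ltW -> ->.
- by rewrite ler_pdivrMr // [leRHS]mulrC.
Qed.
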